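(* Let $X$ be a finite set, $1\le K\le|X|$, and let $f:2^X\to\mathbb{R}$ be a polymatroid set function with total curvature $c\in(0,1]$ and total $k$-batch curvatures $\{c_k\}_{k=1}^K$. Then $c_{k_2}\le c_{k_1}$ whenever $1\le k_1\le k_2\le K$.
   Context: Polymatroid set function: $f:2^X\to\mathbb{R}$ with $f(\emptyset)=0$ that is nondecreasing ($f(A)\le f(B)$ for $A\subseteq B\subseteq X$) and submodular ($f(A\cup\{j\})-f(A)\ge f(B\cup\{j\})-f(B)$ for $A\subseteq B\subseteq X$, $j\in X\setminus B$). Notation: $\varrho_T(A)=f(A\cup T)-f(A)$ for $A,T\subseteq X$, and $\varrho_j=\varrho_{\{j\}}$. Total curvature: $c=\max_{j\in X^*}\left\{1-\frac{\varrho_j(X\setminus\{j\})}{\varrho_j(\emptyset)}\right\}$, where $X^*=\{j\in X:\varrho_j(\emptyset)\ne 0\}$. Total $k$-batch curvature: $c_k=\max_{I\in\hat X}\left\{1-\frac{\varrho_I(X\setminus I)}{\varrho_I(\emptyset)}\right\}$, where $\hat X=\{I\subseteq X:\varrho_I(\emptyset)\ne 0,\ |I|=k\}$. In the paper $K$ is the maximal cardinality of a set in a constraint matroid on $X$; the matroid plays no other role here. *)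

(* Defs.v *)
From mathcomp Require Import all_boot all_order all_algebra.
From mathcomp Require Import reals.
Set Implicit Arguments.
Unset Strict Implicit.
Unset Printing Implicit Defensive.
Import Order.TTheory GRing.Theory Num.Theory.
Local Open Scope ring_scope.

(* The maximum of the values of F on A. The seed of the iterated max is itself
   one of these values, so the result is not truncated from below; it is 0 when
   A is empty. *)
Definition max_over (R : realType) (I : finType) (A : {set I}) (F : I -> R) : R :=
  let s := [seq F i | i in A] in \big[Num.max/head 0 s]_(x <- s) x.

Lemma max_over_ub (R : realType) (I : finType) (A : {set I}) (F : I -> R) (i : I) :
  i \in A -> F i <= max_over A F.
Proof.
by move=> iA; apply: le_bigmax_seq => //; apply/imageP; exists i.
Qed.

Lemma max_over_attained (R : realType) (I : finType) (A : {set I}) (F : I -> R) :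
  A != set0 -> exists2 i, i \in A & max_over A F = F i.
Proof.
case/set0Pn=> i0 i0A; apply/imageP; rewrite /max_over.
set s := image _ _.
have hs : head 0 s \in s.
  have : F i0 \in s by apply/imageP; exists i0.
  by case: (s) => // a t _; rewrite mem_head.
rewrite -/s big_seq; elim/big_ind: _ => // x y xs ys.
by rewrite /Order.max; case: ifP.
Qed.

Section SetFunctions.

Variables (R : realType) (X : finType).
Implicit Types (f : {set X} -> R) (A B T I : {set X}) (j : X) (k : nat).

Record polymatroid f : Prop := Polymatroid {
  polymatroid0 : f set0 = 0;
  polymatroid_mono : forall A B, A \subset B -> f A <= f B;
  polymatroid_submod : forall A B j, A \subset B -> j \notin B ->
    f (A :|: [set j]) - f A >= f (B :|: [set j]) - f B
}.

(* $\varrho_T(A)$: the increment T comes before the base set A. *)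
Definition marginal f T A : R := f (A :|: T) - f A.

Definition Xstar f : {set X} := [set j | marginal f [set j] set0 != 0].

Definition total_curvature f : R :=
  max_over (Xstar f)
    (fun j => 1 - marginal f [set j] (setT :\: [set j]) / marginal f [set j] set0).

Definition Xhat f k : {set {set X}} :=
  [set I : {set X} | (marginal f I set0 != 0) && (#|I| == k)].

Definition batch_curvature f k : R :=
  max_over (Xhat f k)
    (fun I => 1 - marginal f I (setT :\: I) / marginal f I set0).

End SetFunctions.

(* Main.v *)
Require Import Defs.
From mathcomp Require Import all_boot all_order all_algebra.
From mathcomp Require Import reals lra.
Set Implicit Arguments.
Unset Strict Implicit.
Unset Printing Implicit Defensive.
Import Order.TTheory GRing.Theory Num.Theory.
Local Open Scope ring_scope.

(** Let [g I = f X - f (X \ I)], the marginal of [I] on its complement. The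
    curvature [c_k] is the least [c >= 0] such that [(1 - c) * f I <= g I] for
    every [I] of size [k] ([batch_curvature_lower], [batch_curvature_le]), so it
    suffices to show that an inequality [l * f <= g], with [l >= 0], passes from
    the sets of size [k] to the sets of size [k + 1], for [k >= 1].

    Let [I] have size [k + 1], and sum over the [k + 1] sets [I \ i]. Since [f]
    is submodular, the increment of [f] caused by an element of [I] is smallest
    when that element comes last ([sum_last_marginals_le]), hence
    [k * f I <= \sum_i f (I \ i)]. The function [g] is supermodular, and dually
    [\sum_i g (I \ i) <= k * g I] (by [marginal_le_sum]). The inequalities for
    the sets [I \ i] therefore add up to [l * (k * f I) <= k * g I], and one
    divides by [k] ([compl_marginal_lower_succ]). *)

Lemma set_add1_ind (T : finType) (P : {set T} -> Prop) :
  P set0 -> (forall x (A : {set T}), x \notin A -> P A -> P (x |: A)) ->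
  forall A, P A.
Proof.
move=> P0 PU A; have [n] := ubnP #|A|; elim: n A => // n IHn A.
have [-> // | [x xA]] := set_0Vmem A.
rewrite (cardsD1 x) xA => ltAn; rewrite -(setD1K xA).
by apply: PU; [rewrite setD11 | apply: IHn].
Qed.

Section Polymatroid.

Variables (R : realType) (X : finType) (f : {set X} -> R).
Hypothesis f_poly : polymatroid f.
Implicit Types (A B T I : {set X}) (j : X) (k : nat) (c l : R).

Lemma marginal_on_set0 T : marginal f T set0 = f T.
Proof. by rewrite /marginal set0U (polymatroid0 f_poly) subr0. Qed.

Lemma marginal_ge0 T A : 0 <= marginal f T A.
Proof. by rewrite subr_ge0 (polymatroid_mono f_poly) ?subsetUl. Qed.

Lemma polymatroid_ge0 A : 0 <= f A.
Proof. by rewrite -marginal_on_set0 marginal_ge0. Qed.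

Lemma marginalU1 j T A :
  marginal f (j |: T) A = marginal f T A + marginal f [set j] (A :|: T).
Proof.
by rewrite /marginal [j |: T]setUC setUA; lra.
Qed.

Lemma marginal1_antitone A B j :
  A \subset B -> marginal f [set j] B <= marginal f [set j] A.
Proof.
move=> sAB; have [jB | jB] := boolP (j \in B); last first.
  exact: (polymatroid_submod f_poly).
have -> : marginal f [set j] B = 0.
  by rewrite /marginal setUC (setUidPr _) ?sub1set // subrr.
exact: marginal_ge0.
Qed.

(** Adjoining the elements of [T] one at a time, each increment shrinks when
    the base set grows. *)
Lemma marginal_antitone T A B :
  A \subset B -> marginal f T B <= marginal f T A.
Proof.
move=> sAB; elim/set_add1_ind: T => [|j T _ IHT].
  by rewrite /marginal !setU0 !subrr.
by rewrite !marginalU1 lerD // marginal1_antitone // setSU.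
Qed.

Lemma marginal_le_sum T A :
  marginal f T A <= \sum_(i in T) marginal f [set i] A.
Proof.
elim/set_add1_ind: T => [|j T jT IHT].
  by rewrite /marginal setU0 subrr big_set0.
rewrite marginalU1 big_setU1 //= addrC lerD //.
by apply: marginal1_antitone; apply: subsetUl.
Qed.

(** Building [I] one element at a time, [i] is adjoined to a subset of
    [I :\ i], so that it contributes at least as much as when it comes last. *)
Lemma sum_last_marginals_le I :
  \sum_(i in I) marginal f [set i] (I :\ i) <= f I.
Proof.
(* T is the part of I built so far. *)
suff: forall T, T \subset I ->
    \sum_(i in T) marginal f [set i] (I :\ i) <= marginal f T set0.
  by move/(_ I (subxx I)); rewrite marginal_on_set0.
move=> T; elim/set_add1_ind: T => [|j T jT IHT].
  by rewrite big_set0 marginal_ge0.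
rewrite subUset => /andP[_ sTI].
rewrite big_setU1 //= marginalU1 set0U addrC lerD ?IHT //.
by apply: marginal1_antitone; rewrite subsetD1 sTI.
Qed.

(** Each element of [I] lies in [k] of the [k + 1] sets [I :\ i], so that an
    additive function sums over them to exactly [k] times its value at [I].
    Submodularity makes the sum at least that for [f], and at most that for the
    marginal on the complement: both deviations favour the conclusion. *)
Lemma compl_marginal_lower_succ l k : 0 <= l -> (0 < k)%N ->
    (forall I, #|I| = k -> l * f I <= marginal f I (~: I)) ->
  forall I, #|I| = k.+1 -> l * f I <= marginal f I (~: I).
Proof.
move=> l0 k0 lower I cardI.
have f_avg : k%:R * f I <= \sum_(i in I) f (I :\ i).
  have := sum_last_marginals_le I.
  under eq_bigr => i iI do rewrite /marginal setUC setD1K //.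
  rewrite sumrB sumr_const cardI mulrS -[f I *+ k]mulr_natl; lra.
have g_avg : \sum_(i in I) marginal f (I :\ i) (~: (I :\ i))
    <= k%:R * marginal f I (~: I).
  (* Both g (I \ i) and the increment of i on X \ I are differences along the
     chain X \ I, X \ (I \ i), X, and they add up to g I. *)
  have -> : \sum_(i in I) marginal f (I :\ i) (~: (I :\ i)) =
      marginal f I (~: I) *+ k.+1 - \sum_(i in I) marginal f [set i] (~: I).
    rewrite -cardI -sumr_const -sumrB; apply: eq_bigr => i iI.
    rewrite /marginal setUC setUCr [~: I :|: I]setUC setUCr.
    by rewrite setCD; lra.
  have := marginal_le_sum I (~: I).
  by rewrite mulrS -[marginal f I _ *+ k]mulr_natl; lra.
have kR0 : 0 < k%:R :> R by rewrite ltr0n.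
rewrite -(ler_pM2l kR0) mulrCA.
apply: le_trans g_avg; apply: le_trans (ler_wpM2l l0 f_avg) _.
rewrite mulr_sumr; apply: ler_sum => i iI; apply: lower.
by move: cardI; rewrite (cardsD1 i) iI => -[].
Qed.

Lemma compl_marginal_lower_mono l k1 k2 : 0 <= l -> (0 < k1 <= k2)%N ->
    (forall I, #|I| = k1 -> l * f I <= marginal f I (~: I)) ->
  forall I, #|I| = k2 -> l * f I <= marginal f I (~: I).
Proof.
move=> l0 /andP[k10 k12] lower; rewrite -(subnKC k12).
elim: (k2 - k1)%N => [|n IHn]; first by rewrite addn0.
by rewrite addnS; apply: compl_marginal_lower_succ; rewrite ?addn_gt0 ?k10.
Qed.

Lemma batch_curvature_bounds k : 0 <= batch_curvature f k <= 1.
Proof.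
rewrite /batch_curvature; have [-> | Xk] := eqVneq (Xhat f k) set0.
  by rewrite /max_over /image_mem enum_set0 big_nil lexx ler01.
have [I] := max_over_attained
  (fun I => 1 - marginal f I (setT :\: I) / marginal f I set0) Xk.
rewrite inE => /andP[fI _] ->.
have fI0 : 0 < marginal f I set0 by rewrite lt_def fI marginal_ge0.
rewrite subr_ge0 ler_pdivrMr // mul1r marginal_antitone ?sub0set //=.
by rewrite lerBlDr lerDl divr_ge0 ?marginal_ge0.
Qed.

(** Sets with [f I = 0] do not enter the maximum defining the curvature, but
    for them the inequality says only that marginals are nonnegative. *)
Lemma batch_curvature_lower k I : #|I| = k ->
  (1 - batch_curvature f k) * f I <= marginal f I (~: I).
Proof.
move=> cardI; have [-> | fI] := eqVneq (f I) 0.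
  by rewrite mulr0 marginal_ge0.
have XI : I \in Xhat f k by rewrite inE marginal_on_set0 fI cardI eqxx.
have fI0 : 0 < f I by rewrite lt_def fI polymatroid_ge0.
have := max_over_ub
  (fun I => 1 - marginal f I (setT :\: I) / marginal f I set0) XI.
by rewrite -/(batch_curvature f k) /= marginal_on_set0 setTD lerBlDr addrC
  -lerBlDr ler_pdivlMr.
Qed.

(** The hypothesis [0 <= c] covers the case where [f] vanishes on all sets of
    size [k]: the maximum is then over the empty family, and equals [0]. *)
Lemma batch_curvature_le c k : 0 <= c ->
    (forall I, #|I| = k -> (1 - c) * f I <= marginal f I (~: I)) ->
  batch_curvature f k <= c.
Proof.
move=> c0 lower; rewrite /batch_curvature.
have [-> | Xk] := eqVneq (Xhat f k) set0.
  by rewrite /max_over /image_mem enum_set0 big_nil.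
have [I] := max_over_attained
  (fun I => 1 - marginal f I (setT :\: I) / marginal f I set0) Xk.
rewrite inE marginal_on_set0 => /andP[fI /eqP/lower lowerI] ->.
have fI0 : 0 < f I by rewrite lt_def fI polymatroid_ge0.
by rewrite setTD lerBlDr addrC -lerBlDr ler_pdivlMr.
Qed.

End Polymatroid.

Theorem theorem3p4 (R : realType) (X : finType) (K : nat) (f : {set X} -> R)
    (K_ge1 : (1 <= K)%N) (K_le : (K <= #|X|)%N)
    (f_poly : polymatroid f)
    (c_gt0 : 0 < total_curvature f) (c_le1 : total_curvature f <= 1)
    (k1 k2 : nat) (k1_ge1 : (1 <= k1)%N) (k12 : (k1 <= k2)%N) (k2_le : (k2 <= K)%N) :
  batch_curvature f k2 <= batch_curvature f k1.
Proof.
have /andP[ck0 ck1] := batch_curvature_bounds f_poly k1.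
apply: (batch_curvature_le f_poly) => //.
apply: (compl_marginal_lower_mono (k1 := k1) f_poly); rewrite ?subr_ge0 ?k1_ge1 //.
exact: batch_curvature_lower.
Qed.
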